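(* Let $B$ be a Cantor real base and for all $n\in\mathbb{Z}$, let $\mathbf{a}_n=a_{n,1}a_{n,2}\cdots$ be a sequence of non-negative integers such that $\mathrm{val}_{S^n(B)}(0\bullet\mathbf{a}_n)=1$. Assume moreover that for all $n\in\mathbb{Z}$, if $\mathbf{a}_n$ ends in $0^\omega$ then \[ a_{n,j+1}a_{n,j+2}\cdots <_{\mathrm{lex}}\mathbf{a}_{n-j}\quad\text{for all }j\ge 1, \] and if $\mathbf{a}_n$ does not end in $0^\omega$ then \[ a_{n,j+1}a_{n,j+2}\cdots \le_{\mathrm{lex}}\mathbf{a}_{n-j}\quad\text{for all }j\ge 1. \] Then $\mathbf{a}_n=\mathbf{t}_n$ for all $n\in\mathbb{Z}$ such that $\mathbf{a}_n$ ends in a tail of zeros, and $\mathbf{a}_n=\mathbf{d}_n$ for all $n\in\mathbb{Z}$ such that $\mathbf{a}_n$ does not end in a tail of zeros, where $\mathbf{t}_n$ and $\mathbf{d}_n$ are the greedy and quasi-greedy $S^n(B)$-expansions of $1$.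
   Context: A Cantor real base is a bi-infinite sequence $B=(\beta_n)_{n\in\mathbb{Z}}$ of real numbers $\beta_n>1$ with $\prod_{n=1}^{+\infty}\beta_n=\prod_{n=1}^{+\infty}\beta_{-n}=+\infty$. For $n\in\mathbb{Z}$, $S^n(B)=(\beta_{m+n})_{m\in\mathbb{Z}}$. For a one-sided infinite sequence $\mathbf{a}=a_1a_2\cdots$ of non-negative integers, $\mathrm{val}_{S^n(B)}(0\bullet\mathbf{a})=\sum_{j=1}^{+\infty}\frac{a_j}{\beta_{n-1}\beta_{n-2}\cdots\beta_{n-j}}$. For $n\in\mathbb{Z}$, the greedy $S^n(B)$-expansion of $1$, denoted $\mathbf{t}_n$, is the lexicographically greatest infinite sequence $\mathbf{t}$ of non-negative integers with $\mathrm{val}_{S^n(B)}(0\bullet\mathbf{t})=1$. The quasi-greedy $S^n(B)$-expansion of $1$, denoted $\mathbf{d}_n$, is the lexicographically greatest infinite sequence $\mathbf{d}$ of non-negative integers not ending in a tail of zeros with $\mathrm{val}_{S^n(B)}(0\bullet\mathbf{d})=1$. $0^\omega$ is the constant infinite sequence of zeros; a sequence ends in $0^\omega$ (in a tail of zeros) if all but finitely many of its terms are $0$. $<_{\mathrm{lex}}$, $\le_{\mathrm{lex}}$ denote the lexicographic order on infinite sequences of non-negative integers. *)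

(* Defs.v *)
From mathcomp Require Import all_boot all_order all_algebra.
From mathcomp Require Import all_classical all_reals all_analysis.
Import Order.TTheory GRing.Theory Num.Theory.
Import numFieldNormedType.Exports.

Set Implicit Arguments.
Unset Strict Implicit.
Unset Printing Implicit Defensive.

Local Open Scope classical_set_scope.
Local Open Scope ring_scope.

(* A one-sided sequence a_1 a_2 ... of non-negative integers, indexed from 0:
   the digit a_j is [a j.-1]. The order is the lexicographic one. *)
Definition digits : Type := big_lexi_order (fun _ : nat => nat).

Lemma digits_ltP (a b : digits) :
  (a < b)%O <-> exists k, (forall i, (i < k)%N -> a i = b i) /\ (a k < b k)%N.
Proof.
split=> [|[k [pk ltk]]].
  rewrite lt_neqAle leEbig_lexi_order => /andP[neq].
  case E: first_diff => [k|].
    move=> le_k; exists k; move/first_diff_SomeP: E => [pre nk].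
    by split; [exact: pre | rewrite ltn_neqAle nk].
  by move/first_diff_NoneP: E neq => ->; rewrite eqxx.
have E : first_diff (a : forall _, nat) b = Some k.
  by apply/first_diff_SomeP; split; [exact: pk | rewrite ltn_eqF].
rewrite lt_neqAle leEbig_lexi_order E leEnat (ltnW ltk) andbT.
by apply/eqP => eab; rewrite eab ltnn in ltk.
Qed.

(* [dtail j a] is the sequence a_(j+1) a_(j+2) ... *)
Definition dtail (j : nat) (a : digits) : digits := fun k => a (j + k)%N.

Definition ends_in_zeros (a : digits) : Prop := \forall k \near \oo, a k = 0%N.

Section CantorRealBase.
Context {R : realType}.
Implicit Types (B : int -> R) (a d t : digits).

Definition cantor_real_base B : Prop :=
  [/\ forall n, 1 < B n,
      \prod_(1 <= k < N.+1) B k%:Z @[N --> \oo] --> +oo &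
      \prod_(1 <= k < N.+1) B (- k%:Z) @[N --> \oo] --> +oo].

Definition shift_base (n : int) B : int -> R := fun m => B (m + n).

(* val_B(0 . a), as a sum of non-negative terms in [0, +oo]; the term of index
   j is a_(j+1) / (B_(-1) ... B_(-(j+1))). *)
Definition frac_val B a : \bar R :=
  (\sum_(0 <= j <oo) ((a j)%:R / \prod_(1 <= k < j.+2) B (- k%:Z))%:E)%E.

Definition greedy_expansion_of_1 B t : Prop :=
  frac_val B t = 1%E /\ forall s : digits, frac_val B s = 1%E -> (s <= t)%O.

Definition quasi_greedy_expansion_of_1 B d : Prop :=
  [/\ ~ ends_in_zeros d, frac_val B d = 1%E &
      forall s : digits,
        ~ ends_in_zeros s -> frac_val B s = 1%E -> (s <= d)%O].

Lemma greedy_expansion_of_1_unique B t t' :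
  greedy_expansion_of_1 B t -> greedy_expansion_of_1 B t' -> t = t'.
Proof.
by move=> [vt mt] [vt' mt']; apply/le_anti; rewrite (mt' _ vt) (mt _ vt').
Qed.

Lemma quasi_greedy_expansion_of_1_unique B d d' :
  quasi_greedy_expansion_of_1 B d -> quasi_greedy_expansion_of_1 B d' -> d = d'.
Proof.
move=> [nd vd md] [nd' vd' md']; apply/le_anti.
by rewrite (md' _ nd vd) (md _ nd' vd').
Qed.

End CantorRealBase.

(* Main.v *)
Require Import Defs.
From mathcomp Require Import all_boot all_order all_algebra.
From mathcomp Require Import all_classical all_reals all_analysis.
From mathcomp Require Import zify lra.
Import Order.TTheory GRing.Theory Num.Theory.
Import numFieldNormedType.Exports.
Local Open Scope ring_scope.

(** Let [s] be a sequence each of whose tails [dtail j s] is at most [a (m - j)].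
    At the first difference between [s] and [a m], the digit of [s] loses at
    least 1, while by induction on the number of terms the rest of [s] is worth
    at most 1 at that scale: hence every partial sum of [s] in base [S^m(B)] is
    at most 1 (less than 1 if the tails are strictly smaller). This applies to
    the tails of [a n]. If now [a n < s] with both of value 1, then at the first
    difference the digit of [s] gains at least 1, which the rest of [a n] can
    compensate only if it is worth 1 and [s] stops there; the former is
    excluded when [a n] ends in zeros, the latter when [s] does not. *)

Section PartialSums.
Context {R : realType} (B : int -> R) (B_gt1 : forall n, 1 < B n).
Implicit Types (m : int) (s t : digits).

(** The denominator $\beta_{m-1}\cdots\beta_{m-k-1}$ under the digit of index [k]; as indices start
    at 0, it has [k.+1] factors. *)
Definition scale m k : R := \prod_(1 <= i < k.+2) shift_base m B (- i%:Z).

Definition psum m s N : R := \sum_(0 <= j < N) (s j)%:R / scale m j.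

Lemma scale_gt0 m k : 0 < scale m k.
Proof. by apply: prodr_gt0 => i _; exact: lt_trans ltr01 (B_gt1 _). Qed.

Lemma scaleD m k j : scale m (k.+1 + j) = scale m k * scale (m - k.+1%:Z) j.
Proof.
rewrite /scale (big_cat_nat _ (n := k.+2)) //=; last by lia.
congr (_ * _); rewrite -{1}(add1n k.+1) big_addn.
have -> : ((k.+1 + j).+2 - k.+1 = j.+2)%N by lia.
by apply: eq_bigr => i _; rewrite /shift_base; congr B; lia.
Qed.

(** By [scaleD], the digits after index [k] form a partial sum in the base shifted to [m - k.+1],
    which is why tails are compared with [a (m - j)]. *)
Lemma psumS m s k N : psum m s (k.+1 + N) =
  psum m s k + ((s k)%:R + psum (m - k.+1%:Z) (dtail k.+1 s) N) / scale m k.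
Proof.
rewrite /psum (big_cat_nat _ (n := k.+1)) ?leq_addr //= big_nat_recr //=.
rewrite -addrA mulrDl; congr (_ + (_ + _)).
rewrite -{1}(add0n k.+1) big_addn addKn mulr_suml.
apply: eq_bigr => j _; rewrite addnC scaleD /dtail.
by rewrite invfM mulrA mulrAC.
Qed.

Lemma psumS1 m s k : psum m s k.+1 = psum m s k + (s k)%:R / scale m k.
Proof. by rewrite /psum big_nat_recr. Qed.

Lemma term_ge0 m s j : 0 <= (s j)%:R / scale m j.
Proof. by rewrite divr_ge0// ltW// scale_gt0. Qed.

Lemma psum_monotone m s : {homo psum m s : M N / (M <= N)%N >-> M <= N}.
Proof.
apply: homo_leq => // [x y z|N]; first exact: le_trans.
by rewrite psumS1 lerDl term_ge0.
Qed.

Lemma eq_psum m s t N :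
  (forall i, (i < N)%N -> s i = t i) -> psum m s N = psum m t N.
Proof. by move=> st; apply: eq_big_nat => i /= /st ->. Qed.

Lemma frac_valE m s :
  frac_val (shift_base m B) s = limn (fun N => (psum m s N)%:E).
Proof. by congr (limn _); apply/funext => N; rewrite sumEFin. Qed.

Lemma cvg_psum m s : cvgn (fun N => (psum m s N)%:E).
Proof.
under eq_fun do rewrite -sumEFin.
by apply: is_cvg_nneseries => j _ _; rewrite lee_fin term_ge0.
Qed.

Lemma psum_le1 m s N : frac_val (shift_base m B) s = 1%E -> psum m s N <= 1.
Proof.
move=> v1; rewrite -lee_fin -v1 -sumEFin.
by apply: nneseries_lim_ge => j _ _; rewrite lee_fin term_ge0.
Qed.

Lemma le_psum_bound m s M (c : R) : frac_val (shift_base m B) s = 1%E ->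
  (forall N, psum m s (M + N) <= c) -> 1 <= c.
Proof.
move=> v1 sc; rewrite -lee_fin -[X in (X <= _)%E]v1 frac_valE.
apply: lime_le; first exact: cvg_psum.
by exists M => // N /= MN; rewrite lee_fin -(subnKC MN).
Qed.

Lemma psum_ends_in_zeros m s : frac_val (shift_base m B) s = 1%E ->
  ends_in_zeros s -> exists M, forall N, psum m s (M + N) = 1.
Proof.
move=> v1 [M _ s0].
have sM N : psum m s (M + N) = psum m s M.
  rewrite /psum (big_cat_nat _ (n := M)) ?leq_addr //= [X in _ + X]big_nat.
  rewrite [X in _ + X]big1 ?addr0// => i /andP[Mi _].
  by rewrite (s0 _ Mi) mul0r.
exists M => N; rewrite sM; apply/eqP; rewrite eq_le psum_le1//=.
by apply: (le_psum_bound _ _ M _ v1) => K; rewrite sM.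
Qed.

(** Here [c] is the worth of what follows digit [k] of [s]; the larger digit of [t] outweighs it as
    soon as [c <= 1]. *)
Lemma psum_lt_digit m s t k (c : R) :
  (forall i, (i < k)%N -> s i = t i) -> (s k < t k)%N ->
  psum m s k + ((s k)%:R + c) / scale m k <=
  psum m t k.+1 + (c - 1) / scale m k.
Proof.
move=> st skt; rewrite (eq_psum _ _ _ _ st) psumS1 -addrA lerD2l -mulrDl.
rewrite ler_pM2r ?invr_gt0 ?scale_gt0//.
have : (s k).+1%:R <= (t k)%:R :> R by rewrite ler_nat.
by rewrite -natr1; lra.
Qed.

(** The flag [b] treats the large ([true]) and strict ([false]) bounds together. The induction on
    [N] varies [m] and [s], since it passes to a tail in a shifted base. *)
Lemma psum_lteif1 (a : int -> digits) (b : bool) N m s :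
  (forall n, frac_val (shift_base n B) (a n) = 1%E) ->
  (forall j, (dtail j s < a (m - j%:Z) ?<= if b)%O) ->
  psum m s N < 1 ?<= if b.
Proof.
move=> va; elim/ltn_ind: N m s => N IH m s sa.
have := sa 0%N; rewrite subr0 -[dtail 0 s]/s.
have [/eqP->|sam] := boolP (s == a m).
  by case: b {IH sa} => /=; rewrite ?ltxx// psum_le1.
move=> sam'.
have /digits_ltP[k [st skt]] : (s < a m)%O.
  by rewrite lt_neqAle sam; exact: lteifW sam'.
have Pk := scale_gt0 m k.
have [Nk|kN] := leqP N k.
  (* The first [N] digits agree with [a m], whose digit [k] is still to come and positive, so the
     bound is strict for both values of [b]. *)
  have : psum m s N < 1; last by case: (b) => //= /ltW.
  apply: le_lt_trans (psum_monotone _ _ _ _ Nk) _.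
  rewrite (eq_psum _ _ _ _ st).
  apply: lt_le_trans (psum_le1 _ _ k.+1 (va m)).
  by rewrite psumS1 ltrDl divr_gt0// ltr0n (leq_ltn_trans _ skt).
rewrite -(subnKC kN) psumS.
set c := psum (m - _) _ _.
have : c < 1 ?<= if b.
  apply: IH; first by lia.
  move=> j; have := sa (k.+1 + j)%N.
  have -> : m - (k.+1 + j)%N%:Z = m - k.+1%:Z - j%:Z by lia.
  by congr (_ < _ ?<= if _)%O; apply/funext => i; rewrite /dtail addnA.
have := psum_lt_digit m _ _ _ c st skt.
have := psum_le1 _ _ k.+1 (va m).
move=> a1 le1.
case: (b) => /= c1; last apply: (le_lt_trans le1); first apply: (le_trans le1).
- apply: le_trans a1; rewrite gerDl.
  by rewrite pmulr_lle0 ?invr_gt0// subr_le0.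
- apply: lt_le_trans a1; rewrite gtrDl.
  by rewrite pmulr_llt0 ?invr_gt0// subr_lt0.
Qed.

End PartialSums.

Theorem proposition5 (R : realType) (B : int -> R) (a : int -> digits)
  (hB : cantor_real_base B)
  (hval : forall n : int, frac_val (shift_base n B) (a n) = 1%E)
  (hfin : forall n : int, ends_in_zeros (a n) ->
     forall j : nat, (1 <= j)%N -> (dtail j (a n) < a (n - j%:Z))%O)
  (hinf : forall n : int, ~ ends_in_zeros (a n) ->
     forall j : nat, (1 <= j)%N -> (dtail j (a n) <= a (n - j%:Z))%O) :
  (forall n : int, ends_in_zeros (a n) ->
     greedy_expansion_of_1 (shift_base n B) (a n)) /\
  (forall n : int, ~ ends_in_zeros (a n) ->
     quasi_greedy_expansion_of_1 (shift_base n B) (a n)).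
Proof.
have [B1 _ _] := hB.
have tail_lteif n (b : bool) k N :
    (forall j, (1 <= j)%N -> (dtail j (a n) < a (n - j%:Z) ?<= if b)%O) ->
    psum B (n - k.+1%:Z) (dtail k.+1 (a n)) N < 1 ?<= if b.
  move=> ha; apply: psum_lteif1 => // j.
  have -> : n - k.+1%:Z - j%:Z = n - (k.+1 + j)%N%:Z by lia.
  rewrite (_ : dtail j _ = dtail (k.+1 + j) (a n)); first exact: ha.
  by apply/funext => i; rewrite /dtail addnA.
split=> n an.
  split=> // s vs; rewrite leNgt; apply/negP => /digits_ltP[k [st skt]].
  have [M aM] := psum_ends_in_zeros _ B1 _ _ (hval n) an.
  (* The value 1 is reached by a finite partial sum, so [c < 1] is not weakened by a limit. *)
  have := aM k.+1; rewrite addnC psumS.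
  have := tail_lteif n false k M (hfin n an).
  set c := psum _ _ _ _ => /= c1 ac.
  have := psum_lt_digit _ B1 n _ _ _ c st skt; rewrite ac => le1.
  have := psum_le1 _ B1 _ _ k.+1 vs.
  have : (c - 1) / scale B n k < 0.
    by rewrite pmulr_llt0 ?invr_gt0 ?scale_gt0// subr_lt0.
  by move: le1; lra.
split=> // s ns vs; rewrite leNgt; apply/negP => /digits_ltP[k [st skt]].
have /existsNP[i /not_implyP[ki /eqP si]] : ~ (forall i, (k < i)%N -> s i = 0%N).
  by move=> s0; apply: ns; exists k.+1.
(* The nonzero digit [s i] after [k] leaves the partial sum through [k] short of 1. *)
have : psum B n s k.+1 < 1.
  apply: lt_le_trans (psum_le1 _ B1 _ _ i.+1 vs).
  rewrite (psumS1 _ _ _ i) ltr_pwDr ?psum_monotone//.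
  by rewrite divr_gt0 ?scale_gt0// ltr0n lt0n.
apply/negP; rewrite -leNgt.
(* Only [c <= 1] is available here, but it bounds all long partial sums of [a n] by
   [psum B n s k.+1], hence also their limit 1. *)
apply: (le_psum_bound _ B1 _ _ k.+1 _ (hval n)) => N.
have /= := tail_lteif n true k N (hinf n an).
rewrite psumS; set c := psum _ _ _ _ => /= c1.
apply: le_trans (psum_lt_digit _ B1 n _ _ _ c st skt) _.
by rewrite gerDl pmulr_lle0 ?invr_gt0 ?scale_gt0// subr_le0.
Qed.
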